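(* Let $\mu,\nu\in\mathcal{P}(\mathbb{X})$ with $\mu\ll\nu$ and let $\gamma\in\Gamma_{C-P}$. Let $\pi_t=\pi_t^\mu$ be the predictor started from the (true) prior $\mu$ and $\hat\pi_t=\pi_t^\nu$ the predictor started from the (incorrect) prior $\nu$, both driven by the same data generated under $\gamma$ with $x_0\sim\mu$, as described in the context. Then for all $t\ge0$, $$E^\gamma_\mu\big[\|\pi_{t+1}-\hat\pi_{t+1}\|_{TV}\big]\le 2\Big(1-\min_{u\in\mathbb{U}}\delta(P,u)\Big)E^\gamma_\mu\big[\|\pi_t-\hat\pi_t\|_{TV}\big].$$
   Context: $\mathbb{X}$ (states), $\mathbb{U}$ (actions), $\mathbb{M}$ (channel symbols) are finite nonempty sets and $P(x'\mid x,u)$ is the transition kernel of the controlled source $x_{t+1}=f(x_t,u_t,w_t)$, $w_t$ i.i.d. and independent of $x_0$. $\mathcal{Q}=\{Q:\mathbb{X}\to\mathbb{M}\}$, $\mathcal{H}=\{\eta:\mathcal{Q}\times\mathbb{M}\to\mathbb{U}\}$, $\mathcal{P}(\mathbb{X})$ is the set of probability measures on $\mathbb{X}$. A policy $\gamma\in\Gamma_{C-P}$ is a sequence of measurable maps $\gamma_t:\mathcal{P}(\mathbb{X})\to\mathcal{Q}\times\mathcal{H}$; it is applied with the true predictor: $(Q_t,\eta_t)=\gamma_t(\pi^\mu_t)$, $q_t=Q_t(x_t)$, $u_t=\eta_t(Q_t,q_t)$, with $x_0\sim\mu$. $E^\gamma_\mu$ is the corresponding expectation. The predictors satisfy $\pi_0^\mu=\mu$,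 $\pi_0^\nu=\nu$, and, with the same realized $(Q_t,\eta_t,q_t)$, $\pi^\mu_{t+1}=F(\pi^\mu_t,Q_t,\eta_t,q_t)$, $\pi^\nu_{t+1}=F(\pi^\nu_t,Q_t,\eta_t,q_t)$, where $$F(\pi,Q,\eta,q)(x')=\frac{1}{\pi(Q^{-1}(q))}\sum_{x\in Q^{-1}(q)}P(x'\mid x,\eta(Q,q))\pi(x)$$ (the denominators are positive almost surely because $\mu\ll\nu$). $\|\cdot\|_{TV}$ is the total variation norm $\|\mu-\nu\|_{TV}=\sup_{\|h\|_\infty\le1}|\int h\,d\mu-\int h\,d\nu|$. The Dobrushin coefficient is $\delta(P,u)=\min_{i,k\in\mathbb{X}}\sum_{j\in\mathbb{X}}\min(P(j\mid i,u),P(j\mid k,u))$. *)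

(* Defs.v *)
From HB Require Import structures.
From mathcomp Require Import all_boot all_order all_algebra finmap.
From mathcomp Require Import all_classical all_reals all_analysis.

Set Implicit Arguments.
Unset Strict Implicit.
Unset Printing Implicit Defensive.

Import Order.TTheory GRing.Theory Num.Theory.

Local Open Scope classical_set_scope.
Local Open Scope ring_scope.

(* P(X) for a finite set X: the probability mass functions on X. *)
Record dist (R : realType) (X : finType) := Dist {
  pmf_of :> {ffun X -> R};
  _ : [forall x, 0 <= pmf_of x] && (\sum_(x : X) pmf_of x == 1) }.

HB.instance Definition _ (R : realType) (X : finType) :=
  [isSub for @pmf_of R X].

(* The Borel sigma-algebra of the simplex P(X): it is generated by the
   evaluations p |-> p x. *)
Definition dist_borel (R : realType) (X : finType) : set (set (dist R X)) :=
  <<s [set A | exists (x : X) (B : set R),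
         measurable B /\ A = (fun p : dist R X => p x) @^-1` B] >>.

Definition abs_cont (R : realType) (X : finType) (mu nu : dist R X) : Prop :=
  forall A : {set X}, \sum_(x in A) nu x = 0 -> \sum_(x in A) mu x = 0.

Definition tv_norm (R : realType) (X : finType) (mu nu : dist R X) : R :=
  sup [set r | exists2 h : X -> R, (forall x, `|h x| <= 1) &
         r = `| \sum_(x : X) h x * mu x - \sum_(x : X) h x * nu x | ].

(* A transition kernel P (x' | x, u) is written [P x u x']. *)
Definition kern (R : realType) (X U : finType) := X -> U -> dist R X.

(* Each sum below is at most 1, so taking 1 as the neutral element of the
   iterated minimum does not change its value on nonempty index sets. *)
Definition dobrushin (R : realType) (X U : finType) (P : kern R X U) (u : U)
    : R :=
  \big[Num.min/1]_(i : X) \big[Num.min/1]_(k : X)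
    \sum_(j : X) Num.min (P i u j) (P k u j).

Definition min_dobrushin (R : realType) (X U : finType) (P : kern R X U) : R :=
  \big[Num.min/1]_(u : U) dobrushin P u.

Definition quantizer (X M : finType) := {ffun X -> M}.
Definition decoder (X M U : finType) := {ffun quantizer X M * M -> U}.

Section Predictor.
Context (R : realType) (X U M : finType) (P : kern R X U).

Definition predictor_formula (p : dist R X) (Q : quantizer X M)
    (eta : decoder X M U) (q : M) : {ffun X -> R} :=
  [ffun x' => (\sum_(x | Q x == q) p x)^-1 *
              \sum_(x | Q x == q) P x (eta (Q, q)) x' * p x].

(* The update F. If the cell of q has p-mass zero, the formula does not define
   a probability measure and [insubd] returns the irrelevant value p; otherwise
   F is given by the formula, see [FE]. *)
Definition F (p : dist R X) (Q : quantizer X M) (eta : decoder X M U) (q : M)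
    : dist R X :=
  insubd p (predictor_formula p Q eta q).

Lemma dist_ge0 (p : dist R X) x : 0 <= p x.
Proof. by case: p => p /= /andP[/forallP]. Qed.

Lemma dist_sum1 (p : dist R X) : \sum_x p x = 1.
Proof. by case: p => p /= /andP[_ /eqP]. Qed.

Lemma FE (p : dist R X) (Q : quantizer X M) (eta : decoder X M U)
    (q : M) (x' : X) :
  0 < \sum_(x | Q x == q) p x ->
  F p Q eta q x' = (\sum_(x | Q x == q) p x)^-1 *
                   \sum_(x | Q x == q) P x (eta (Q, q)) x' * p x.
Proof.
move=> p0; rewrite /F val_insubd ifT ?ffunE//; apply/andP; split.
  apply/forallP => x; rewrite ffunE mulr_ge0 ?invr_ge0 ?(ltW p0)//.
  by apply: sumr_ge0 => y _; rewrite mulr_ge0 ?dist_ge0.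
under eq_bigr do rewrite ffunE.
rewrite -mulr_sumr exchange_big /=.
under [X in _ * X]eq_bigr do rewrite -mulr_suml dist_sum1 mul1r.
by rewrite mulVf// gt_eqF.
Qed.

End Predictor.

(* gamma_t : P(X) -> Q x H; the codomain is finite and carries the discrete
   sigma-algebra. *)
Definition policy (R : realType) (X U M : finType) :=
  nat -> dist R X -> quantizer X M * decoder X M U.

Definition policy_measurable (R : realType) (X U M : finType)
    (gamma : policy R X U M) : Prop :=
  forall t (A : set (quantizer X M * decoder X M U)),
    dist_borel (gamma t @^-1` A).

Section ClosedLoop.
Context (R : realType) (X U M : finType) (Omega W : Type).
Context (P : kern R X U) (f : X -> U -> W -> X).
Context (x0 : Omega -> X) (w : nat -> Omega -> W).
Context (mu : dist R X) (gamma : policy R X U M).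

(* (x_t, pi_t^mu) *)
Fixpoint closed_loop (t : nat) (om : Omega) : X * dist R X :=
  if t is t'.+1 then
    let: (x, p) := closed_loop t' om in
    let: (Q, eta) := gamma t' p in
    (f x (eta (Q, Q x)) (w t' om), F P p Q eta (Q x))
  else (x0 om, mu).

(* The predictor started from rho, driven by the data (Q_t, eta_t, q_t) of the
   closed loop in which the policy is applied to pi_t^mu and x_0 ~ mu. *)
Fixpoint predictor (rho : dist R X) (t : nat) (om : Omega) : dist R X :=
  if t is t'.+1 then
    let: (x, p) := closed_loop t' om in
    let: (Q, eta) := gamma t' p in
    F P (predictor rho t' om) Q eta (Q x)
  else rho.

Lemma predictor_mu t om : predictor mu t om = (closed_loop t om).2.
Proof.
elim: t => //= t ->; case: (closed_loop t om) => x p /=.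
by case: (gamma t p).
Qed.

End ClosedLoop.

Section Noise.
Context (d d' : measure_display) (Omega : measurableType d)
  (W : measurableType d') (R : realType) (Pr : probability Omega R).

Definition mutually_independent (I : choiceType) (G : I -> set (set Omega)) :=
  forall (J : {fset I}) (E : I -> set Omega),
    (forall i, i \in J -> G i (E i)) ->
    Pr (\bigcap_(i in [set` J]) E i) = (\prod_(i <- J) Pr (E i))%E.

Definition identically_distributed (w : nat -> {RV Pr >-> W}) :=
  forall t (B : set W), measurable B ->
    Pr (w t @^-1` B) = Pr (w 0%N @^-1` B).

(* The sigma-algebras generated by x_0 (index None) and by w_t (index Some t).
   Their mutual independence says that the w_t are independent of each other
   and that (w_t)_t is independent of x_0. *)
Definition source_sigma (X : finType) (x0 : Omega -> X)
    (w : nat -> {RV Pr >-> W}) (i : option nat) : set (set Omega) :=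
  if i is Some t then preimage_set_system setT (w t) measurable
  else preimage_set_system setT x0 setT.

End Noise.

(* Main.v *)
Require Import Defs.
From mathcomp Require Import all_boot all_order all_algebra finmap.
From mathcomp Require Import all_classical all_reals all_analysis.
From mathcomp Require Import measurable_realfun ring lra.

(** The joint law of state and predictors is carried by finitely many state
    paths, so that both expectations are finite sums ([expectation_path]) and
    the inequality splits into two independent facts.

    The first is probabilistic: [pi_t^mu] is the conditional law of [x_t] given
    the past observations, so for every function [H] of the state and of the two
    predictors, [E H(x_t, pi_t, pi'_t) = E (sum_x pi_t(x) H(x, pi_t, pi'_t))]
    ([predictor_posterior]). Applied to the distance of the updated predictors,
    which depend on [x_t] only through [q_t = Q_t(x_t)], it shows that [q_t] may
    be drawn from [pi_t].

    The second is about two fixed measures [p << q] ([tv_F]): averaged over an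
    observation drawn from [p], the distance after one update is at most
    [2 (1 - delta)] times the distance before. Conditioning on the observed cell
    costs the factor [2] because both the measures and their normalisations
    change; the transition then contracts by [1 - delta], as in Dobrushin's
    theorem ([dobrushin_contraction]). Absolute continuity is inherited by the
    predictors along every path of positive probability
    ([path_weight_gt0]). *)

Import Order.TTheory GRing.Theory Num.Theory.

Local Open Scope classical_set_scope.
Local Open Scope ring_scope.

Set Implicit Arguments.
Unset Strict Implicit.
Unset Printing Implicit Defensive.

(** * Total variation and Dobrushin's contraction *)

Section TotalVariation.
Context (R : realType) (X : finType).
Implicit Types p q : dist R X.

(** The supremum is attained at the sign of [p - q]. *)
Lemma tv_normE p q : tv_norm p q = \sum_x `|p x - q x|.
Proof.
rewrite /tv_norm; set E := [set r | _].
have ubE : ubound E (\sum_x `|p x - q x|).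
  move=> _ [h h1 ->]; rewrite -sumrB; under eq_bigr do rewrite -mulrBr.
  apply: le_trans (ler_norm_sum _ _ _) _; apply: ler_sum => x _.
  by rewrite normrM ler_piMl.
have EE : E (\sum_x `|p x - q x|).
  exists (fun x => Num.sg (p x - q x)) => [x|].
    by rewrite normr_sg; case: (_ != _).
  rewrite -sumrB; under [X in _ = `|X|]eq_bigr do rewrite -mulrBr -normrEsg.
  by rewrite [RHS]ger0_norm// sumr_ge0.
apply/eqP; rewrite eq_le ge_sup//=; last by exists (\sum_x `|p x - q x|).
by apply: ub_le_sup => //; exists (\sum_x `|p x - q x|).
Qed.

Lemma tv_norm_ge0 p q : 0 <= tv_norm p q.
Proof. by rewrite tv_normE sumr_ge0. Qed.

(** The overlap form, which relates total variation to the Dobrushin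
    coefficient: [|a - b| = a + b - 2 min a b]. *)
Lemma tv_norm_min p q : tv_norm p q = 2 * (1 - \sum_x Num.min (p x) (q x)).
Proof.
transitivity (\sum_x (p x + q x - 2 * Num.min (p x) (q x))).
  rewrite tv_normE; apply: eq_bigr => x _.
  by case: (leP (p x) (q x)) => pq; [rewrite ler0_norm|rewrite gtr0_norm]; lra.
by rewrite sumrB -mulr_sumr big_split/= !dist_sum1; ring.
Qed.

(** A zero-sum weight is a mixture of differences of two point masses: with
    [pos] and [neg] the positive and negative parts of [e], both of mass [m],
    [m * e] is the sum of [pos x * neg k] times the difference of the point
    masses at [x] and at [k]. Each such difference is sent to [K x - K k], whose
    total variation is at most [2 * (1 - delta)]. *)
Lemma dobrushin_contraction (Y : finType) (K : Y -> dist R X) (delta : R)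
    (e : Y -> R) :
  (forall i k, delta <= \sum_j Num.min (K i j) (K k j)) ->
  \sum_y e y = 0 ->
  \sum_j `|\sum_y e y * K y j| <= (1 - delta) * \sum_y `|e y|.
Proof.
move=> hdelta e0.
pose pos y := (`|e y| + e y) / 2; pose neg y := (`|e y| - e y) / 2.
pose m := (\sum_y `|e y|) / 2.
have pos0 y : 0 <= pos y.
  by rewrite /pos divr_ge0// -[X in _ + X]opprK subr_ge0 -normrN ler_norm.
have neg0 y : 0 <= neg y by rewrite /neg divr_ge0// subr_ge0 ler_norm.
have posm : \sum_y pos y = m by rewrite -mulr_suml big_split/= e0 addr0.
have negm : \sum_y neg y = m by rewrite -mulr_suml sumrB e0 subr0.
have posneg y : e y = pos y - neg y by rewrite /pos /neg; field.
have m0 : 0 <= m by rewrite -posm sumr_ge0.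
have mE : \sum_y `|e y| = 2 * m by rewrite /m; field.
have [mz|mn0] := eqVneq m 0.
  have ez y : e y = 0.
    move: mE; rewrite mz mulr0 => /eqP; rewrite psumr_eq0//.
    by move=> /allP/(_ y (mem_index_enum _))/eqP; exact: normr0_eq0.
  rewrite mE mz !mulr0 big1// => j _; rewrite big1 ?normr0// => y _.
  by rewrite ez mul0r.
have mgt0 : 0 < m by rewrite lt_def mn0.
have mixture j : m * (\sum_y e y * K y j) =
    \sum_y \sum_k pos y * neg k * (K y j - K k j).
  transitivity (\sum_y \sum_k (neg k * (pos y * K y j)) -
                \sum_y \sum_k (pos y * (neg k * K k j))).
    under [X in _ = X - _]eq_bigr do rewrite -mulr_suml negm.
    under [X in _ - X]eq_bigr do rewrite -mulr_sumr.
    rewrite -mulr_suml posm -!mulr_sumr -mulrBr -sumrB; congr (_ * _).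
    by apply: eq_bigr => y _; rewrite posneg; ring.
  rewrite -sumrB; apply: eq_bigr => y _; rewrite -sumrB.
  by apply: eq_bigr => k _; ring.
rewrite -(ler_pM2l mgt0) mulr_sumr mE.
under eq_bigr do rewrite -{1}(gtr0_norm mgt0) -normrM mixture.
apply: (@le_trans _ _
    (\sum_y \sum_k pos y * neg k * (2 * (1 - delta)))); last first.
  under eq_bigr do rewrite -mulr_suml -mulr_sumr negm.
  rewrite -2!mulr_suml posm.
  by rewrite [leRHS](_ : _ = m * m * (2 * (1 - delta)))//; ring.
apply: (@le_trans _ _
    (\sum_j \sum_y \sum_k pos y * neg k * `|K y j - K k j|)).
  apply: ler_sum => j _; apply: le_trans (ler_norm_sum _ _ _) _.
  apply: ler_sum => y _; apply: le_trans (ler_norm_sum _ _ _) _.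
  by apply: ler_sum => k _; rewrite normrM ger0_norm// mulr_ge0.
rewrite exchange_big; apply: ler_sum => y _.
rewrite exchange_big; apply: ler_sum => k _.
rewrite -mulr_sumr; apply: ler_wpM2l; first exact: mulr_ge0.
rewrite -tv_normE tv_norm_min.
by rewrite ler_pM2l// lerD2l lerN2.
Qed.

End TotalVariation.

(** * One step of the filter *)

Section Filter.
Context (R : realType) (X U M : finType) (P : kern R X U).
Implicit Types (p q : dist R X) (eta : decoder X M U).

Lemma min_dobrushin_le u i k :
  min_dobrushin P <= \sum_j Num.min (P i u j) (P k u j).
Proof.
apply: le_trans (bigmin_le _ u _) _; apply: le_trans (bigmin_le _ i _) _.
exact: bigmin_le.
Qed.

Lemma min_dobrushin_le1 : min_dobrushin P <= 1.
Proof. exact: bigmin_le_id. Qed.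

Definition cell p (Q : quantizer X M) (m : M) : R := \sum_(x | Q x == m) p x.

Lemma cell_ge0 p Q m : 0 <= cell p Q m.
Proof. by rewrite sumr_ge0// => x _; exact: dist_ge0. Qed.

Lemma cell_gt0 p (Q : quantizer X M) x : 0 < p x -> 0 < cell p Q (Q x).
Proof.
move=> px; rewrite /cell (bigD1 x)//= ltr_pwDl// sumr_ge0// => y _.
exact: dist_ge0.
Qed.

Lemma abs_cont_cell p q (Q : quantizer X M) m :
  abs_cont p q -> 0 < cell p Q m -> 0 < cell q Q m.
Proof.
move=> pq pm; rewrite lt_def cell_ge0 andbT; apply/eqP => qm.
have := pq [set x | Q x == m]%SET.
under eq_bigl do rewrite inE; under [X in _ -> X = _]eq_bigl do rewrite inE.
by move=> /(_ qm) pm0; move: pm; rewrite /cell pm0 ltxx.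
Qed.

Lemma abs_contP p q : (forall x, q x = 0 -> p x = 0) <-> abs_cont p q.
Proof.
split=> [pq A qA|pq x qx]; last first.
  by have := pq [set x]%SET; rewrite !big_set1; apply.
apply: big1 => x xA; apply: pq.
move/eqP: qA; rewrite psumr_eq0 => [|y _]; last exact: dist_ge0.
by move=> /allP/(_ x (mem_index_enum _))/implyP/(_ xA)/eqP.
Qed.

Lemma cell_F p (Q : quantizer X M) eta m x' : 0 < cell p Q m ->
  cell p Q m * F P p Q eta m x' =
  \sum_(x | Q x == m) P x (eta (Q, m)) x' * p x.
Proof. by move=> pm; rewrite FE// mulrA mulfV ?mul1r// gt_eqF. Qed.

Lemma F_gt0 p (Q : quantizer X M) eta x x' :
  0 < p x -> 0 < P x (eta (Q, Q x)) x' -> 0 < F P p Q eta (Q x) x'.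
Proof.
move=> px Px; have pm := cell_gt0 Q px.
rewrite -(pmulr_rgt0 _ pm) cell_F// (bigD1 x)//= ltr_pwDl ?mulr_gt0//.
by apply: sumr_ge0 => y _; rewrite mulr_ge0// dist_ge0.
Qed.

Lemma abs_cont_F p q (Q : quantizer X M) eta m :
  abs_cont p q -> 0 < cell p Q m ->
  abs_cont (F P p Q eta m) (F P q Q eta m).
Proof.
move=> pq pm; have qm := abs_cont_cell pq pm; apply/abs_contP => x' qx'.
apply: (mulfI (lt0r_neq0 pm)); rewrite mulr0 cell_F//.
have /eqP := cell_F eta x' qm; rewrite qx' mulr0 eq_sym psumr_eq0.
  move=> /allP q0; apply: big1 => x Qx.
  have /implyP/(_ Qx) := q0 x (mem_index_enum _).
  rewrite mulf_eq0 => /orP[/eqP->|/eqP/((abs_contP p q).2 pq)->];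
  by rewrite ?mul0r ?mulr0.
by move=> x _; rewrite mulr_ge0// dist_ge0.
Qed.

(** The unnormalised contraction on one cell. With [c] the ratio of the two
    cell masses, [p - c q] has zero sum on the cell, and it is pushed forward
    to [cell p * (F p - F q)]; replacing [c q] by [q] costs once more the
    distance of [p] and [q] on the cell, hence the factor [2]. *)
Lemma tv_F_cell p q (Q : quantizer X M) eta m : abs_cont p q ->
  cell p Q m * tv_norm (F P p Q eta m) (F P q Q eta m) <=
  2 * (1 - min_dobrushin P) * \sum_(x | Q x == m) `|p x - q x|.
Proof.
move=> pq.
have d0 : 0 <= 1 - min_dobrushin P by rewrite subr_ge0 min_dobrushin_le1.
have [pm0|pm0] := eqVneq (cell p Q m) 0.
  by rewrite pm0 mul0r !mulr_ge0// sumr_ge0.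
have pm : 0 < cell p Q m by rewrite lt_def pm0 cell_ge0.
have qm := abs_cont_cell pq pm.
pose c := cell p Q m / cell q Q m.
have c0 : 0 <= c by rewrite divr_ge0 ?cell_ge0.
have cq : c * cell q Q m = cell p Q m by rewrite /c divfK// gt_eqF.
pose e x := if Q x == m then p x - c * q x else 0.
have e0 : \sum_x e x = 0.
  by rewrite -big_mkcond/= sumrB -mulr_sumr -/(cell q Q m) cq subrr.
have pushforward : cell p Q m * tv_norm (F P p Q eta m) (F P q Q eta m) =
    \sum_j `|\sum_x e x * P x (eta (Q, m)) j|.
  rewrite tv_normE mulr_sumr; apply: eq_bigr => j _.
  rewrite -{1}(gtr0_norm pm) -normrM mulrBr cell_F// -cq -mulrA cell_F//.
  rewrite mulr_sumr -sumrB big_mkcond/=; congr (`|_|).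
  by apply: eq_bigr => x _; rewrite /e; case: ifP => _; ring.
rewrite pushforward.
have := dobrushin_contraction (fun i k => min_dobrushin_le (eta (Q, m)) i k) e0.
move=> /le_trans; apply; rewrite [2 * _]mulrC -mulrA ler_wpM2l//.
have -> : \sum_x `|e x| = \sum_(x | Q x == m) `|p x - c * q x|.
  rewrite [RHS]big_mkcond; apply: eq_bigr => x _; rewrite /e.
  by case: ifP; rewrite ?normr0.
apply: (@le_trans _ _ (\sum_(x | Q x == m) `|p x - q x| +
                       \sum_(x | Q x == m) `|1 - c| * q x)).
  rewrite -big_split/=; apply: ler_sum => x _.
  rewrite -[X in _ + _ * X](ger0_norm (dist_ge0 q x)) -normrM.
  have -> : p x - c * q x = (p x - q x) + (1 - c) * q x by ring.
  exact: ler_normD.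
rewrite -mulr_sumr -/(cell q Q m) -[X in _ * X](gtr0_norm qm) -normrM.
rewrite mulrBl mul1r cq distrC -sumrB mulr2n mulrDl mul1r lerD2l.
exact: ler_norm_sum.
Qed.

(** Drawing [x] from [p] produces the observation [m] with probability
    [cell p Q m], so the left-hand side is the sum over [m] of those of
    [tv_F_cell]. *)
Lemma tv_F p q (Q : quantizer X M) eta : abs_cont p q ->
  \sum_x p x * tv_norm (F P p Q eta (Q x)) (F P q Q eta (Q x)) <=
  2 * (1 - min_dobrushin P) * tv_norm p q.
Proof.
move=> pq; rewrite tv_normE mulr_sumr.
rewrite (partition_big Q predT)//= [leRHS](partition_big Q predT)//=.
apply: ler_sum => m _; rewrite -[leRHS]mulr_sumr.
apply: le_trans _ (tv_F_cell Q eta m pq); rewrite mulr_suml.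
by apply: ler_sum => x /eqP ->.
Qed.

End Filter.

(** * Finite state paths and the posterior property *)

Section Paths.
Context (R : realType) (X U M : finType) (P : kern R X U).
Context (mu nu : dist R X) (gamma : policy R X U M).

(** Paths are listed with the most recent state first, and [l] holds the states
    strictly before the current one. The policy is always fed the predictor
    started from [mu], while [rho] is the prior of the predictor returned. *)
Fixpoint path_predictor (rho : dist R X) (l : seq X) : dist R X :=
  if l is x :: l' then
    let g := gamma (size l') (path_predictor mu l') in
    F P (path_predictor rho l') g.1 g.2 (g.1 x)
  else rho.

Definition path_action (x : X) (l : seq X) : U :=
  let g := gamma (size l) (path_predictor mu l) in g.2 (g.1, g.1 x).

Fixpoint path_weight (x : X) (l : seq X) : R :=
  if l is y :: l' then path_weight y l' * P y (path_action y l') x else mu x.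

(** The expectation of [G x_t [:: x_(t-1); ...; x_0]], by [expectation_path]
    below. *)
Definition path_sum (t : nat) (G : X -> seq X -> R) : R :=
  \sum_(l : t.-tuple X) \sum_x path_weight x l * G x l.

Lemma path_weight_ge0 x l : 0 <= path_weight x l.
Proof.
elim: l x => [|y l IH] x /=; first exact: dist_ge0.
by rewrite mulr_ge0// dist_ge0.
Qed.

Lemma path_sum0 G : path_sum 0 G = \sum_x mu x * G x [::].
Proof.
rewrite /path_sum (big_pred1 [tuple])// => l.
by rewrite [l]tuple0; apply/esym/eqP.
Qed.

(** The Markov property: the last state is integrated out first. *)
Lemma path_sumS t G :
  path_sum t.+1 G =
  path_sum t (fun x l => \sum_y P x (path_action x l) y * G y (x :: l)).
Proof.
rewrite /path_sum.
rewrite (reindex (fun xl : X * t.-tuple X => [tuple of xl.1 :: xl.2])).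
  rewrite -(pair_big predT predT (fun x (l : t.-tuple X) =>
    \sum_y path_weight y (x :: l) * G y (x :: l)))/= exchange_big.
  apply: eq_bigr => l _; apply: eq_bigr => x _; rewrite mulr_sumr.
  by apply: eq_bigr => y _; rewrite mulrA.
exists (fun l : t.+1.-tuple X => (thead l, [tuple of behead l])) => [[x l]|l] _.
  by congr (_, _); apply/val_inj.
by rewrite [RHS]tuple_eta.
Qed.

Lemma eq_path_sum t G H :
  (forall x (l : seq X), size l = t -> G x l = H x l) ->
  path_sum t G = path_sum t H.
Proof.
move=> GH; apply: eq_bigr => l _; apply: eq_bigr => x _.
by rewrite GH// size_tuple.
Qed.

Lemma le_path_sum t G H :
  (forall x (l : seq X), 0 < path_weight x l -> size l = t -> G x l <= H x l) ->
  path_sum t G <= path_sum t H.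
Proof.
move=> GH; apply: ler_sum => l _; apply: ler_sum => x _.
have := path_weight_ge0 x l; rewrite le_eqVlt => /orP[/eqP<-|w0].
  by rewrite !mul0r.
by rewrite ler_pM2l// GH// size_tuple.
Qed.

Lemma path_sumZ t a G :
  path_sum t (fun x l => a * G x l) = a * path_sum t G.
Proof.
rewrite /path_sum mulr_sumr; apply: eq_bigr => l _; rewrite mulr_sumr.
by apply: eq_bigr => x _; rewrite mulrCA.
Qed.

(** The first conclusion is what carries absolute continuity along the path: it
    makes the observed cell have positive predicted mass, so that neither
    update takes the default value of [F]. *)
Lemma path_weight_gt0 x l : abs_cont mu nu -> 0 < path_weight x l ->
  0 < path_predictor mu l x /\
  abs_cont (path_predictor mu l) (path_predictor nu l).
Proof.
move=> munu; elim: l x => [|y l IH] x //= w0.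
have wy : 0 < path_weight y l.
  rewrite lt_def path_weight_ge0 andbT; apply/eqP => wy.
  by move: w0; rewrite wy mul0r ltxx.
have [py pac] := IH _ wy; rewrite pmulr_rgt0// in w0.
by split; [exact: F_gt0|apply: abs_cont_F => //; exact: cell_gt0].
Qed.

(** On the cell of [m], both sides are the unnormalised prediction
    [cell p Q m * F p] integrated against [h _ m]; on a cell of zero mass all
    the weights [p x] vanish. *)
Lemma predict_correct (p : dist R X) (Q : quantizer X M) (eta : decoder X M U)
    (h : X -> M -> R) :
  \sum_x p x * \sum_y P x (eta (Q, Q x)) y * h y (Q x) =
  \sum_x p x * \sum_y F P p Q eta (Q x) y * h y (Q x).
Proof.
rewrite (partition_big Q predT)//= [RHS](partition_big Q predT)//=.
apply: eq_bigr => m _.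
transitivity (\sum_(x | Q x == m) \sum_y P x (eta (Q, m)) y * p x * h y m).
  apply: eq_bigr => x /eqP ->; rewrite mulr_sumr.
  by apply: eq_bigr => y _; rewrite mulrA [p x * _]mulrC.
transitivity (cell p Q m * \sum_y F P p Q eta m y * h y m); last first.
  by rewrite mulr_suml; apply: eq_bigr => x /eqP ->.
rewrite exchange_big mulr_sumr; apply: eq_bigr => y _.
rewrite -mulr_suml mulrA; congr (_ * _).
have [pm|pm] := eqVneq (cell p Q m) 0; last first.
  by rewrite cell_F// lt_def pm cell_ge0.
rewrite pm mul0r big1// => x Qx; move/eqP: pm.
rewrite psumr_eq0 => [|z _]; last exact: dist_ge0.
by move=> /allP/(_ x (mem_index_enum _))/implyP/(_ Qx)/eqP ->; rewrite mulr0.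
Qed.

(** [path_predictor mu] is the conditional law of the state given the
    observations. The induction needs no explicit conditioning: the quantifier
    over [H] plays the role of the observed information, since the two
    predictors (hence [H]) depend on the past only through the observations.
    In the step, the induction hypothesis draws the state at time [t] from its
    predictor on both sides, and [predict_correct] compares the results. *)
Lemma predictor_posterior t (H : X -> dist R X -> dist R X -> R) :
  path_sum t (fun x l => H x (path_predictor mu l) (path_predictor nu l)) =
  path_sum t (fun _ l => \sum_x path_predictor mu l x *
                           H x (path_predictor mu l) (path_predictor nu l)).
Proof.
elim: t H => [|t IH] H.
  by rewrite !path_sum0 -[RHS]mulr_suml dist_sum1 mul1r.
pose K (p q : dist R X) : R := \sum_y p y * H y p q.
pose step (p q : dist R X) x (h : dist R X -> dist R X -> R) : R :=
  let g := gamma t p in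
  h (F P p g.1 g.2 (g.1 x)) (F P q g.1 g.2 (g.1 x)).
rewrite !path_sumS.
(* Right-hand side: the new state is averaged out, so only the updated
   predictors remain, and they are functions of the state at time t. *)
transitivity (path_sum t (fun x l =>
    step (path_predictor mu l) (path_predictor nu l) x K)); last first.
  apply: eq_path_sum => x l lt.
  by rewrite /= lt -mulr_suml dist_sum1 mul1r.
rewrite (IH (fun x p q => step p q x K)).
(* Left-hand side: the new state is drawn from the transition kernel. *)
pose next x (p q : dist R X) : R := \sum_y
  P x (let g := gamma t p in g.2 (g.1, g.1 x)) y * step p q x (H y).
transitivity (path_sum t (fun x l =>
    next x (path_predictor mu l) (path_predictor nu l))).
  by apply: eq_path_sum => x l lt; rewrite /next /step /path_action /= lt.
rewrite (IH next); apply: eq_path_sum => _ l _.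
rewrite /next /step /=; set g := gamma t _.
exact: (predict_correct _ _ _
  (fun y m => H y (F P _ g.1 g.2 m) (F P _ g.1 g.2 m))).
Qed.

(** The updated predictors do not depend on the new state but do depend on the
    current one, which [predictor_posterior] allows to draw from the true
    predictor, as [tv_F] requires. *)
Lemma path_sum_tv t : abs_cont mu nu ->
  let tv (l : seq X) := tv_norm (path_predictor mu l) (path_predictor nu l) in
  path_sum t.+1 (fun _ => tv) <=
  2 * (1 - min_dobrushin P) * path_sum t (fun _ => tv).
Proof.
move=> munu /=; rewrite path_sumS -path_sumZ.
pose H x (p q : dist R X) := let g := gamma t p in
  tv_norm (F P p g.1 g.2 (g.1 x)) (F P q g.1 g.2 (g.1 x)).
rewrite [leLHS](@eq_path_sum _ _ (fun x l =>
    H x (path_predictor mu l) (path_predictor nu l))).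
  by rewrite predictor_posterior; apply: le_path_sum => x l w0 _;
    apply: tv_F; case: (path_weight_gt0 munu w0).
by move=> x l lt /=; rewrite lt -mulr_suml dist_sum1 mul1r.
Qed.

End Paths.

(** * The law of the closed loop *)

Lemma bigcap_fsetU1 (T : Type) (I : choiceType) (i : I) (J : {fset I})
    (A : set T) (E : I -> set T) : i \notin J ->
  \bigcap_(j in [set` (i |` J)%fset]) (if j == i then A else E j) =
  A `&` \bigcap_(j in [set` J]) E j.
Proof.
move=> iJ; apply/seteqP; split=> om /=.
  move=> AE; split.
    by have := AE i; rewrite /= eqxx; apply; exact: fset1U1.
  move=> j /= jJ; have := AE j; rewrite /= ifN.
    by apply; rewrite in_fset1U jJ orbT.
  by apply: contraNneq iJ => <-.
move=> [Aom Eom] j /=; rewrite in_fset1U; case: eqP => //= _ jJ; exact: Eom.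
Qed.

Section Law.
Context (R : realType) (X U M : finType)
  (d d' : measure_display) (Omega : measurableType d) (W : measurableType d')
  (Pr : probability Omega R) (f : X -> U -> W -> X)
  (f_measurable : forall (x : X) (u : U) (A : set X),
     measurable (f x u @^-1` A))
  (x0 : Omega -> X)
  (x0_measurable : forall A : set X, measurable (x0 @^-1` A))
  (w : nat -> {RV Pr >-> W})
  (x0_w_indep : mutually_independent Pr (source_sigma x0 w))
  (P : kern R X U)
  (P_kernel : forall (t : nat) (x : X) (u : U) (x' : X),
     Pr [set om | f x u (w t om) = x'] = (P x u x')%:E)
  (mu : dist R X)
  (x0_law : forall x : X, Pr (x0 @^-1` [set x]) = (mu x)%:E)
  (gamma : policy R X U M).

Let state t om := (closed_loop P f x0 w mu gamma t om).1.

Fixpoint past t om : seq X :=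
  if t is t'.+1 then state t' om :: past t' om else [::].

Lemma size_past t om : size (past t om) = t.
Proof. by elim: t => //= t ->. Qed.

Lemma closed_loop_past t om :
  closed_loop P f x0 w mu gamma t om =
  (state t om, path_predictor P mu gamma mu (past t om)).
Proof.
rewrite /state; elim: t => //= t ->/=; rewrite size_past.
by case: (gamma t _).
Qed.

Lemma predictor_past rho t om :
  predictor P f x0 w mu gamma rho t om =
  path_predictor P mu gamma rho (past t om).
Proof.
elim: t => //= t ->; rewrite closed_loop_past/= size_past.
by case: (gamma t _).
Qed.

Definition visits x l : set Omega :=
  [set om | state (size l) om = x /\ past (size l) om = l].

Let noise_event t x u y : set Omega := [set om | f x u (w t om) = y].

Lemma visits_nil x : visits x [::] = x0 @^-1` [set x].
Proof. by apply/seteqP; split => om //= []. Qed.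

Lemma visits_cons x y l : visits y (x :: l) =
  noise_event (size l) x (path_action P mu gamma x l) y `&` visits x l.
Proof.
have stateS om : state (size l).+1 om =
    f (state (size l) om)
      (path_action P mu gamma (state (size l) om) (past (size l) om))
      (w (size l) om).
  rewrite /state/= closed_loop_past/= /path_action size_past.
  by case: (gamma _ _).
apply/seteqP; split => om; rewrite /visits /noise_event /= stateS.
  by move=> [<- [<- pl]]; rewrite pl.
by move=> [<- [-> ->]].
Qed.

Lemma measurable_noise_event t x u y : measurable (noise_event t x u y).
Proof.
rewrite -[noise_event _ _ _ _]/(w t @^-1` (f x u @^-1` [set y])).
exact: measurable_funPTI.
Qed.

Lemma measurable_visits x l : measurable (visits x l).
Proof.
elim: l x => [|y l IH] x; first by rewrite visits_nil.
by rewrite visits_cons; apply: measurableI => //; exact: measurable_noise_event.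
Qed.

(** The event of following a given path up to time [size l] is independent of
    the later noise. Keeping the later events [E] arbitrary lets the induction
    absorb into them, one step at a time, the noise event that extends the
    path; the last step absorbs the event on [x0], whose index is [None]. *)
Lemma visits_indep x l (J : {fset option nat}) (E : option nat -> set Omega) :
  (forall i, i \in J -> exists2 s, (size l <= s)%N & i = Some s) ->
  (forall i, i \in J -> source_sigma x0 w i (E i)) ->
  Pr (visits x l `&` \bigcap_(i in [set` J]) E i) =
  ((path_weight P mu gamma x l)%:E * \prod_(i <- J) Pr (E i))%E.
Proof.
elim: l x J E => [|y l IH] x J E Jl JE.
  have NJ : None \notin J by apply/negP => /Jl[].
  pose E' i := if i == None then visits x [::] else E i.
  have -> : visits x [::] `&` \bigcap_(i in [set` J]) E i =
      \bigcap_(i in [set` (None |` J)%fset]) E' i.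
    by rewrite bigcap_fsetU1.
  rewrite x0_w_indep => [|i].
    rewrite big_fsetU1//= {1}/E' eqxx visits_nil x0_law; congr (_ * _)%E.
    apply: eq_big_seq => i iJ; rewrite /E' ifN//.
    by apply: contraNneq NJ => <-.
  rewrite /E' in_fset1U; case: eqP => [-> _|_ /JE//].
  by exists [set x] => //; rewrite setTI visits_nil.
set i0 := Some (size l); have i0J : i0 \notin J.
  by apply/negP => /Jl[s /= ls [sl]]; rewrite sl ltnn in ls.
set N := noise_event (size l) y (path_action P mu gamma y l) x.
pose E' i := if i == i0 then N else E i.
have -> : visits x (y :: l) `&` \bigcap_(i in [set` J]) E i =
    visits y l `&` \bigcap_(i in [set` (i0 |` J)%fset]) E' i.
  by rewrite bigcap_fsetU1// visits_cons -/N setIA [N `&` _]setIC.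
rewrite IH => [|i|i]; last 2 first.
- rewrite in_fset1U => /orP[/eqP->|/Jl[s /= /ltnW ls ->]].
    by exists (size l).
  by exists s.
- rewrite /E' in_fset1U; case: eqP => [-> _|_ /JE//].
  exists (f y (path_action P mu gamma y l) @^-1` [set x]) => //.
  by rewrite setTI.
rewrite big_fsetU1//= {1}/E' eqxx P_kernel muleA -EFinM; congr (_ * _)%E.
apply: eq_big_seq => i iJ; rewrite /E' ifN//.
by apply: contraNneq i0J => <-.
Qed.

Lemma visits_law x l : Pr (visits x l) = (path_weight P mu gamma x l)%:E.
Proof.
have := @visits_indep x l fset0 (fun=> setT).
by rewrite set_fset0 bigcap_set0 setIT big_seq_fset0 mule1; apply.
Qed.

(** The integrand is a simple function: it takes the value [G x l] on the event
    [visits x l], and these events partition the space. *)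
Lemma expectation_path t (G : X -> seq X -> R) : (forall x l, 0 <= G x l) ->
  ('E_Pr[fun om => G (state t om) (past t om)])%E =
  (path_sum P mu gamma t G)%:E.
Proof.
move=> G0; rewrite unlock.
pose h (lx : t.-tuple X * X) om : \bar R :=
  ((G lx.2 lx.1)%:E * (\1_(visits lx.2 lx.1) om)%:E)%E.
have hE om : (G (state t om) (past t om))%:E = (\sum_lx h lx om)%E.
  have pt : size (past t om) == t by rewrite size_past.
  rewrite (bigD1 (Tuple pt, state t om))//= big1 ?adde0.
    by rewrite /h/= indicE mem_set ?mule1//= /visits/= size_past.
  move=> [l x] /= lx; rewrite /h indicE memNset ?mule0//=.
  rewrite /visits/= size_tuple => -[xE lE]; case/eqP: lx.
  by congr (_, _) => //; apply/val_inj.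
under eq_integral do rewrite hE.
rewrite ge0_integral_sum//=; last 2 first.
- move=> lx; apply: measurable_funeM; apply/measurable_EFinP.
  by apply: measurable_indic; exact: measurable_visits.
- by move=> lx om _; rewrite /h -EFinM lee_fin mulr_ge0.
rewrite /path_sum pair_big/= -sumEFin; apply: eq_bigr => -[l x] _ /=.
rewrite ge0_integralZl//= ?lee_fin//; last first.
  by apply/measurable_EFinP; apply: measurable_indic; exact: measurable_visits.
rewrite integral_indic//; last exact: measurable_visits.
by rewrite setIT [_ * G x l]mulrC EFinM -visits_law.
Qed.

End Law.

(** * The contraction inequality *)

Theorem mainTheorem7 (R : realType) (X U M : finType)
  (X_nonempty : (0 < #|X|)%N) (U_nonempty : (0 < #|U|)%N)
  (M_nonempty : (0 < #|M|)%N)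
  (d d' : measure_display) (Omega : measurableType d) (W : measurableType d')
  (Pr : probability Omega R)
  (f : X -> U -> W -> X)
  (f_measurable : forall (x : X) (u : U) (A : set X),
     measurable (f x u @^-1` A))
  (x0 : Omega -> X)
  (x0_measurable : forall A : set X, measurable (x0 @^-1` A))
  (w : nat -> {RV Pr >-> W})
  (w_ident : identically_distributed w)
  (x0_w_indep : mutually_independent Pr (source_sigma x0 w))
  (P : kern R X U)
  (P_kernel : forall (t : nat) (x : X) (u : U) (x' : X),
     Pr [set om | f x u (w t om) = x'] = (P x u x')%:E)
  (mu nu : dist R X)
  (x0_law : forall x : X, Pr (x0 @^-1` [set x]) = (mu x)%:E)
  (mu_ll_nu : abs_cont mu nu)
  (gamma : policy R X U M)
  (gamma_measurable : policy_measurable gamma)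
  (t : nat) :
  let pi_mu := predictor P f x0 w mu gamma mu in
  let pi_nu := predictor P f x0 w mu gamma nu in
  ('E_Pr[fun om => tv_norm (pi_mu t.+1 om) (pi_nu t.+1 om)]
   <= (2 * (1 - min_dobrushin P))%:E
      * 'E_Pr[fun om => tv_norm (pi_mu t om) (pi_nu t om)])%E.
Proof.
cbv zeta.
pose tv (_ : X) l :=
  tv_norm (path_predictor P mu gamma mu l) (path_predictor P mu gamma nu l).
pose x_ s om := (closed_loop P f x0 w mu gamma s om).1.
have tv_path s :
    (fun om => tv_norm (predictor P f x0 w mu gamma mu s om)
                       (predictor P f x0 w mu gamma nu s om)) =
    (fun om => tv (x_ s om) (past f x0 w P mu gamma s om)).
  by apply/funext => om; rewrite !predictor_past.
have tv0 x l : 0 <= tv x l by exact: tv_norm_ge0.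
have E s := expectation_path f_measurable x0_measurable x0_w_indep P_kernel
  x0_law gamma s tv0.
by rewrite !tv_path !E -EFinM lee_fin; exact: path_sum_tv.
Qed.
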